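(* Let $G$ be a connected graph and $X\subseteq V(G)$. The following are equivalent: (i) $X$ is a total mutual-visibility set of $G$; (ii) any two vertices $u,v$ of $G$ with $d_G(u,v)=2$ are $X$-visible; (iii) any two vertices $u,v$ of $G$ with $d_G(u,v)=2$ satisfy $N_G(u)\cap N_G(v)\not\subseteq X$.
   Context: For $X\subseteq V(G)$, two vertices $x,y$ are $X$-visible if there is a shortest $x,y$-path in $G$ with no internal vertex in $X$; $X$ is a total mutual-visibility set if any two vertices of $V(G)$ are $X$-visible. $N_G(v)$ is the set of neighbours of $v$ and $d_G$ the shortest-path distance. *)

(* Defs.v *)
From mathcomp Require Import all_boot.
From mathcomp Require Import boolp classical_sets.

Set Implicit Arguments.
Unset Strict Implicit.
Unset Printing Implicit Defensive.

Local Open Scope classical_set_scope.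

(* Simple undirected graphs, possibly infinite. *)
Record sgraph := SGraph {
  vertex :> eqType;
  adj : rel vertex;
  adj_sym : symmetric adj;
  adj_irrefl : irreflexive adj }.

Section Visibility.
Variable G : sgraph.
Implicit Types (x y u v : G) (p : seq G) (X : set G).

Definition neighbours v : set G := [set w | adj v w].

(* The path is x :: p, so its length (number of edges) is size p. *)
Definition is_path x y p : bool :=
  [&& path (@adj G) x p, last x p == y & uniq (x :: p)].

Definition connected_graph : Prop := forall x y, exists p, is_path x y p.

Definition has_path_of_length x y (n : nat) : bool :=
  `[< exists2 p, is_path x y p & size p = n >].

(* The value 0 for vertices in distinct components is a junk value. *)
Definition dist x y : nat :=
  if pselect (exists n, has_path_of_length x y n) is left h
  then ex_minn h else 0.

Definition shortest_path x y p : bool := is_path x y p && (size p == dist x y).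

Definition internal_vertices x p : seq G := behead (belast x p).

Definition visible X x y : Prop :=
  exists2 p, shortest_path x y p &
    forall w, w \in internal_vertices x p -> ~ X w.

Definition total_mutual_visibility_set X : Prop :=
  forall x y, visible X x y.

End Visibility.

(* Main.v *)
(* For (iii) => (i), induct on d(x, y): on a shortest path x, a, b, ..., y one
   has d(x, b) = 2, so a can be replaced by a common neighbour a' of x and b
   outside X. Then d(a', y) = d(x, y) - 1, and x followed by a shortest
   a', y-path avoiding X is again a shortest path. *)
Require Import Defs.
From mathcomp Require Import all_boot.
From mathcomp Require Import boolp classical_sets.

Local Open Scope classical_set_scope.

Lemma dist_le_path (G : sgraph) (x y : G) p : is_path x y p -> dist x y <= size p.
Proof.
move=> xPy; have hp : has_path_of_length x y (size p) by apply/asboolP; exists p.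
rewrite /dist; case: pselect => [h|[]]; last by exists (size p).
by case: ex_minnP => m _; apply.
Qed.

Lemma shortest_path_exists (G : sgraph) (x y : G) :
  connected_graph G -> exists p, shortest_path x y p.
Proof.
move=> /(_ x y)[p xPy].
have [q xQy sq] : exists2 q, is_path x y q & size q = dist x y.
  rewrite /dist; case: pselect => [h|[]]; first by case: ex_minnP => m /asboolP.
  by exists (size p); apply/asboolP; exists p.
by exists q; rewrite /shortest_path xQy sq eqxx.
Qed.

(** Cutting the closed detours out of a walk leaves a simple path. The inclusion of vertex sets is
    what later shows that a walk of minimal length repeats no vertex. *)
Lemma shorten_walk (G : sgraph) (x : G) p : path (@adj G) x p ->
  exists q, [/\ is_path x (last x p) q, {subset x :: q <= x :: p}
              & size q <= size p].
Proof.
case/shortenP => q xq Uq sub_qp; have [_ Uq'] := andP Uq.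
exists q; split; first by rewrite /is_path xq eqxx.
  by move=> w; rewrite !inE => /orP[->//|/sub_qp ->]; rewrite orbT.
exact: uniq_leq_size Uq' sub_qp.
Qed.

Lemma dist_le_walk (G : sgraph) (x : G) p :
  path (@adj G) x p -> dist x (last x p) <= size p.
Proof.
by move=> /(@shorten_walk G)[q [/(@dist_le_path G) le_q _]]; apply: leq_trans.
Qed.

(** Simplicity is automatic at minimal length: the shortened path uses only vertices of the walk and
    still has at least [dist x y] edges, so the walk had no repetition. Walks can thus be spliced
    without any disjointness check. *)
Lemma shortest_walkP (G : sgraph) (x y : G) p :
  reflect [/\ path (@adj G) x p, last x p = y & size p = dist x y]
          (shortest_path x y p).
Proof.
apply: (iffP andP) => [[/and3P[xp /eqP -> _] /eqP ->] //|[xp <- sp]].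
have [q [xq sub_qp _]] := @shorten_walk G x p xp.
have [_ _ Uq] := and3P xq; split; last exact/eqP.
rewrite /is_path xp eqxx (leq_size_uniq Uq sub_qp) //= sp ltnS.
exact: dist_le_path.
Qed.

(** The only internal vertex of a path of length 2 is a common neighbour of its ends, and visibility
    keeps it out of [X]. *)
Lemma common_neighbour_of_visible (G : sgraph) (X : set G) (u v : G) :
  dist u v = 2 -> visible X u v -> ~ (neighbours u `&` neighbours v `<=` X).
Proof.
move=> duv [p /shortest_walkP[+ + +] pX]; rewrite duv.
case: p pX => [|w [|z []]] //= pX /and3P[uw wz _] zv _ sX.
apply: (pX w); first by rewrite inE.
by apply: sX; split; rewrite /neighbours //= -zv adj_sym.
Qed.

Lemma total_of_common_neighbours (G : sgraph) (X : set G) :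
  connected_graph G ->
  (forall u v : G, dist u v = 2 -> ~ (neighbours u `&` neighbours v `<=` X)) ->
  total_mutual_visibility_set X.
Proof.
move=> Gconn nbX x y; have [n] := ubnP (dist x y).
(* The start [x] varies in the induction, while [y] stays fixed. *)
elim: n => // n IHn in x *; rewrite ltnS => dn.
have [p sp] := @shortest_path_exists G x y Gconn.
(* A path with at most one edge has no internal vertex. *)
case: p sp => [|a [|b q]] sp; [by exists [::] | by exists [:: a] |].
have /shortest_walkP[/= /and3P[xa ab bq] lq dxy] := sp.
have dxb : dist x b = 2.
  apply/eqP; rewrite eqn_leq.
  have -> /= : dist x b <= 2 by apply: (@dist_le_walk G x [:: a; b]); rewrite /= xa ab.
  (* A shortest [x],[b]-path followed by [q] is an [x],[y]-walk, so its length is at least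
     [dist x y], which is [size q + 2]. *)
  have [r /shortest_walkP[xr lr sr]] := @shortest_path_exists G x b Gconn.
  have := @dist_le_walk G x (r ++ q).
  rewrite cat_path last_cat lr xr bq lq size_cat sr -dxy => /(_ isT).
  by rewrite (leq_add2r (size q) 2).
have [a' [[xa' ba'] a'X]] := nonsubset (nbX x b dxb).
(* Upper bound: go from [a'] to [b], then along [q]. Lower bound: put the edge from [x] to [a']
   before a shortest [a'],[y]-path. *)
have da'y : (dist a' y).+1 = dist x y.
  apply/eqP; rewrite eqn_leq -{1}dxy ltnS; apply/andP; split.
    have := @dist_le_walk G a' (b :: q).
    by rewrite /= bq lq adj_sym ba' => /(_ isT).
  have [r /shortest_walkP[a'r lr <-]] := @shortest_path_exists G a' y Gconn.
  by have := @dist_le_walk G x (a' :: r); rewrite /= xa' a'r lr => /(_ isT).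
have [|r /shortest_walkP[a'r lr sr] rX] := IHn a'; first by rewrite da'y.
exists (a' :: r).
  by apply/shortest_walkP; split; rewrite //= ?xa' // sr.
(* For nonempty [r], the new path has as internal vertices [a'], which lies outside [X], and those
   of the path from [a']. *)
move: rX; rewrite /internal_vertices /=; case: r {a'r lr sr} => //= c r rX w.
by rewrite inE => /orP[/eqP ->|/rX].
Qed.

Theorem theorem5p2 (G : sgraph) (X : set G) (G_connected : connected_graph G) :
  (total_mutual_visibility_set X <->
     (forall u v : G, dist u v = 2 -> visible X u v)) /\
  ((forall u v : G, dist u v = 2 -> visible X u v) <->
     (forall u v : G, dist u v = 2 ->
        ~ (neighbours u `&` neighbours v `<=` X))).
Proof.
have ii_iii : (forall u v : G, dist u v = 2 -> visible X u v) ->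
    forall u v : G, dist u v = 2 -> ~ (neighbours u `&` neighbours v `<=` X).
  by move=> vis u v duv; apply: common_neighbour_of_visible => //; apply: vis.
have iii_i := @total_of_common_neighbours G X G_connected.
(* (i) gives (ii) by restriction to pairs at distance 2, which closes the cycle of implications. *)
split; first by split=> [vis u v _|/ii_iii/iii_i]; first exact: vis.
by split=> [/ii_iii|/iii_i vis u v _]; last exact: vis.
Qed.
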